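(* Let $X$ be a Banach space, let $T\in L(X)$, and consider the operator $B_T$ on $c_0(X,\mathbb{Z})$ or on $\ell^p(X,\mathbb{Z})$ with $1\le p<\infty$. The following assertions are equivalent: (1) $B_T$ is hypercyclic; (2) $B_T$ is weakly mixing; (3) $T$ is weakly mixing on $X$.
   Context: $L(X)$ denotes the bounded linear operators on $X$. $\ell^p(X,\mathbb{Z})$ is the Banach space of families $(x_k)_{k\in\mathbb{Z}}$ in $X$ with $\sum_k\|x_k\|^p<\infty$ (with the $\ell^p$-norm), and $c_0(X,\mathbb{Z})$ is the Banach space of families $(x_k)_{k\in\mathbb{Z}}$ in $X$ with $\lim_{|k|\to\infty}\|x_k\|=0$ (with the sup norm). $B_T$ is the bounded operator $B_T(x_k)_{k\in\mathbb{Z}}=(Tx_{k+1})_{k\in\mathbb{Z}}$. An operator $S$ on a Banach space $Y$ is hypercyclic if some $y\in Y$ has dense orbit $\{S^ny:n\ge 0\}$, and weakly mixing if $S\oplus S$ is hypercyclic on $Y\oplus Y$. *)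

(* Defs.v *)
From HB Require Import structures.
From mathcomp Require Import all_boot all_order all_algebra.
From mathcomp Require Import finmap complex ring zify.
From mathcomp Require Import all_classical all_reals all_analysis.

Set Implicit Arguments.
Unset Strict Implicit.
Unset Printing Implicit Defensive.

Import Order.TTheory GRing.Theory Num.Theory.
Import numFieldNormedType.Exports.

Local Open Scope classical_set_scope.
Local Open Scope ring_scope.

(* Banach spaces are completeNormedModType's over the real or the complex
   numbers. The library's norm takes its values in the scalar field; [rnorm] is
   the same norm as an element of R. *)
Variant scalar_kind := RealScalars | ComplexScalars.

Definition scalar_field (R : realType) (k : scalar_kind) : numFieldType :=
  match k with RealScalars => R | ComplexScalars => R[i] end.

Definition real_of (R : realType) (k : scalar_kind) : scalar_field R k -> R :=
  match k return scalar_field R k -> R with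
  | RealScalars => id
  | ComplexScalars => @complex.Re R
  end.

Definition of_real (R : realType) (k : scalar_kind) : R -> scalar_field R k :=
  match k return R -> scalar_field R k with
  | RealScalars => id
  | ComplexScalars => fun x => x%:C%C
  end.

Definition rnorm (R : realType) (k : scalar_kind)
  (V : normedModType (scalar_field R k)) (x : V) : R := real_of `|x|.
Arguments rnorm {R k V} x.

Section scalar_theory.
Context (R : realType) (k : scalar_kind).
Local Notation K := (scalar_field R k).
Local Notation ofr := (@of_real R k).
Implicit Types (a b : R) (V : normedModType K).

Lemma of_realK a : real_of (ofr a) = a.
Proof. by rewrite /of_real; case: k. Qed.

Lemma of_real0 : ofr 0 = 0. Proof. by rewrite /of_real; case: k. Qed.

Lemma of_realD a b : ofr (a + b) = ofr a + ofr b.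
Proof. by rewrite /of_real; case: k => //=; rewrite rmorphD. Qed.

Lemma of_realM a b : ofr (a * b) = ofr a * ofr b.
Proof. by rewrite /of_real; case: k => //=; rewrite rmorphM. Qed.

Lemma ler_of_real a b : (ofr a <= ofr b) = (a <= b).
Proof. by rewrite /of_real; case: k => //=; rewrite lecR. Qed.

Lemma ltr_of_real a b : (ofr a < ofr b) = (a < b).
Proof. by rewrite /of_real; case: k => //=; rewrite ltcR. Qed.

Lemma real_ofK (z : K) : 0 <= z -> ofr (real_of z) = z.
Proof.
rewrite /of_real /real_of; move: z; case: k => //= z z0.
by apply: RRe_real; rewrite ger0_real.
Qed.

Lemma rnormE V (x : V) : `|x| = ofr (rnorm x).
Proof. by rewrite real_ofK. Qed.

Lemma rnorm_ge0 V (x : V) : 0 <= rnorm x.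
Proof. by rewrite -ler_of_real of_real0 -rnormE. Qed.

Lemma rnorm0 V : rnorm (0 : V) = 0.
Proof. by rewrite /rnorm normr0 -of_real0 of_realK. Qed.

Lemma rnorm_eq0 V (x : V) : rnorm x = 0 -> x = 0.
Proof. by move=> x0; apply/eqP; rewrite -normr_eq0 rnormE x0 of_real0. Qed.

Lemma ler_rnormD V (x y : V) : rnorm (x + y) <= rnorm x + rnorm y.
Proof. by rewrite -ler_of_real of_realD -!rnormE ler_normD. Qed.

Lemma rnormZ V (a : K) (x : V) : rnorm (a *: x) = rnorm (a : K^o) * rnorm x.
Proof.
by rewrite -[RHS]of_realK of_realM -!rnormE -normrZ rnormE of_realK.
Qed.

Lemma rnormN V (x : V) : rnorm (- x) = rnorm x.
Proof. by rewrite /rnorm normrN. Qed.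

Lemma rnormB V (x y : V) : rnorm (x - y) = rnorm (y - x).
Proof. by rewrite /rnorm distrC. Qed.

Lemma linear_rnorm_bounded V (T : {linear V -> V}) :
  bounded_near T (nbhs 0) ->
  exists2 M : R, 0 < M & forall x, rnorm (T x) <= M * rnorm x.
Proof.
move=> /linear_boundedP/pinfty_ex_gt0[M M0 TM].
exists (real_of M); first by rewrite -ltr_of_real real_ofK ?(ltW M0)// of_real0.
move=> x; rewrite -ler_of_real of_realM real_ofK ?(ltW M0)// -!rnormE.
exact: TM.
Qed.

Lemma rnorm_bounded_linear V (T : {linear V -> V}) :
  (exists2 M : R, 0 < M & forall x, rnorm (T x) <= M * rnorm x) ->
  bounded_near T (nbhs 0).
Proof.
move=> [M M0 TM]; apply/linear_boundedP; exists (ofr M); split.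
  by rewrite ger0_real// -of_real0 ler_of_real ltW.
move=> r /ltW Mr x; apply: (@le_trans _ _ (ofr M * `|x|)).
  by rewrite !rnormE -of_realM ler_of_real.
by rewrite ler_wpM2r.
Qed.

Lemma cvg_rnormP V (F : set_system V) {FF : Filter F} (l : V) :
  (forall e, 0 < e -> \forall x \near F, rnorm (l - x) <= e) -> F --> l.
Proof.
move=> Fl; apply/cvgrPdist_le => /= e e0.
have /Fl : 0 < real_of e by rewrite -ltr_of_real real_ofK ?(ltW e0)// of_real0.
by apply: filterS => x; rewrite -ler_of_real real_ofK ?(ltW e0)// -rnormE.
Qed.

Lemma cvg_rnorm V (F : set_system V) {FF : Filter F} (l : V) :
  F --> l -> forall e, 0 < e -> \forall x \near F, rnorm (l - x) <= e.
Proof.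
move=> /cvgrPdist_le Fl e e0.
have /Fl : 0 < ofr e by rewrite -of_real0 ltr_of_real.
by apply: filterS => x /=; rewrite rnormE ler_of_real.
Qed.

Lemma cauchy_rnorm V (F : set_system V) {FF : ProperFilter F} :
  cauchy F -> forall e, 0 < e ->
  exists2 A, F A & forall x y, A x -> A y -> rnorm (x - y) <= e.
Proof.
move=> /cauchyP Fc e e0.
have /Fc[x Fx] : 0 < ofr (e / 2) by rewrite -of_real0 ltr_of_real divr_gt0.
exists (ball x (ofr (e / 2))) => // y z.
rewrite -!ball_normE /ball_/= !rnormE !ltr_of_real => /ltW xy /ltW xz.
rewrite (splitr e) -[y - z](subrKA x) (le_trans (ler_rnormD _ _))//.
by rewrite lerD// rnormB.
Qed.

Lemma rnorm_cauchy V (F : set_system V) {FF : ProperFilter F} :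
  (forall e, 0 < e ->
    exists2 A, F A & forall x y, A x -> A y -> rnorm (x - y) <= e) -> cauchy F.
Proof.
move=> Fc; apply/cauchyP => e e0.
have re0 : 0 < real_of e by rewrite -ltr_of_real real_ofK ?(ltW e0)// of_real0.
have [A FA Ae] := Fc (real_of e / 2) (divr_gt0 re0 (ltr0n _ 2)).
have [x Ax] := filter_ex FA; exists x; apply: filterS FA => y Ay.
rewrite -ball_normE /ball_/= rnormE -(real_ofK (ltW e0)) ltr_of_real.
by rewrite (le_lt_trans (Ae _ _ Ax Ay))// ltr_pdivrMr// ltr_pMr// ltr1n.
Qed.

End scalar_theory.

Section coordinates.
Context (R : realType) (k : scalar_kind)
  (X : completeNormedModType (scalar_field R k)).

Lemma cauchy_coord (Y : normedModType (scalar_field R k)) (ev : Y -> int -> X)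
    (F : set_system Y) {FF : ProperFilter F} :
  (forall x y i, rnorm (ev x i - ev y i) <= rnorm (x - y)) -> cauchy F ->
  exists l : int -> X, forall i, ev x i @[x --> F] --> l i.
Proof.
move=> evle Fc; suff /choice[l lP] : forall i, exists l : X,
    ev x i @[x --> F] --> l by exists l.
move=> i; apply/cvg_ex; apply: cauchy_cvg; apply: rnorm_cauchy => e e0.
have [A FA Ae] := cauchy_rnorm Fc e0.
exists ((ev^~ i) @` A).
  by rewrite /nbhs/=; apply: filterS FA => x Ax; exists x.
by move=> _ _ [x Ax <-] [y Ay <-]; exact: le_trans (evle _ _ _) (Ae _ _ Ax Ay).
Qed.

End coordinates.

(* The Banach space c_0(X, Z). *)
Section c0Z.
Context (R : realType) (k : scalar_kind)
  (X : completeNormedModType (scalar_field R k)).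
Local Notation K := (scalar_field R k).

Definition vanishing (x : int -> X) := forall e : R, 0 < e ->
  exists N : nat, forall i : int, (N <= `|i|)%N -> rnorm (x i) < e.

Definition c0Z_pred : {pred int -> X} := fun x => `[< vanishing x >].

Lemma c0Z_submod_closed : submod_closed c0Z_pred.
Proof.
split.
  apply/asboolP => e e0; exists 0%N => i _; by rewrite rnorm0.
move=> a x y /asboolP x0 /asboolP y0; apply/asboolP => e e0.
set c := rnorm (a : K^o) + 1.
have c0 : 0 < c by rewrite ltr_wpDl// rnorm_ge0.
have [N xN] := x0 (e / 2 / c) (divr_gt0 (divr_gt0 e0 (ltr0n _ 2)) c0).
have [M yM] := y0 (e / 2) (divr_gt0 e0 (ltr0n _ 2)).
exists (maxn N M) => i; rewrite geq_max => /andP[/xN xi /yM yi].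
rewrite (le_lt_trans (ler_rnormD _ _))// (splitr e) ltrD// rnormZ.
move: xi; rewrite ltr_pdivlMr// mulrC; apply: le_lt_trans.
by rewrite ler_wpM2r ?rnorm_ge0// /c lerDl.
Qed.

HB.instance Definition _ :=
  GRing.isSubmodClosed.Build _ _ c0Z_pred c0Z_submod_closed.

Record c0Z := C0Z { c0Z_seq :> int -> X ; c0Z_seqP : c0Z_seq \in c0Z_pred }.

HB.instance Definition _ := [isSub for c0Z_seq].
HB.instance Definition _ := [Choice of c0Z by <:].
HB.instance Definition _ := [SubChoice_isSubLmodule of c0Z by <:].

Definition c0Z_norm (x : c0Z) : R := sup [set rnorm (x i) | i in setT].

Lemma c0Z_bounded (x : c0Z) : has_sup [set rnorm (x i) | i in setT].
Proof.
split; first by exists (rnorm (x 0)), 0.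
have /asboolP/(_ 1 ltr01)[N xN] := c0Z_seqP x.
exists (1 + \sum_(j < N) (rnorm (x j%:Z) + rnorm (x (- j%:Z)))) => _ [i _ <-].
have s0 (j : 'I_N) : true -> 0 <= rnorm (x j%:Z) + rnorm (x (- j%:Z)).
  by rewrite addr_ge0// rnorm_ge0.
have [/xN/ltW xi|iN] := leqP N `|i|%N.
  by rewrite (le_trans xi)// lerDl sumr_ge0.
rewrite (bigD1 (Ordinal iN))//=.
rewrite (@le_trans _ _ (rnorm (x `|i|%N%:Z) + rnorm (x (- `|i|%N%:Z))))//.
  case: (intP i) => [|n|n].
  - by rewrite lerDl rnorm_ge0.
  - by rewrite absz_nat lerDl rnorm_ge0.
  - by rewrite abszN absz_nat lerDr rnorm_ge0.
rewrite addrCA lerDl addr_ge0// sumr_ge0// => j _; exact: s0.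
Qed.

Lemma c0Z_norm_le (x : c0Z) r :
  (c0Z_norm x <= r) <-> (forall i, rnorm (x i) <= r).
Proof.
split=> [xr i|xr].
  apply: le_trans xr; apply: ub_le_sup; last by exists i.
  by case: (c0Z_bounded x).
by apply: ge_sup; [case: (c0Z_bounded x)|move=> _ [i _ <-]].
Qed.

Lemma le_c0Z_norm (x : c0Z) i : rnorm (x i) <= c0Z_norm x.
Proof. exact: (c0Z_norm_le x _).1. Qed.

Let knorm (x : c0Z) : K := of_real k (c0Z_norm x).

Let ler_knormD (x y : c0Z) : knorm (x + y) <= knorm x + knorm y.
Proof.
rewrite /knorm -of_realD ler_of_real; apply/c0Z_norm_le => i.
by rewrite (le_trans (ler_rnormD _ _))// lerD// le_c0Z_norm.
Qed.

Let knormZ a (x : c0Z) : knorm (a *: x) = `|a| * knorm x.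
Proof.
rewrite (rnormE (a : K^o)) /knorm -of_realM; congr (of_real _ _).
have le b (y : c0Z) : c0Z_norm (b *: y) <= rnorm (b : K^o) * c0Z_norm y.
  apply/c0Z_norm_le => i; rewrite [_ i]/(b *: y i) rnormZ.
  by rewrite ler_wpM2l ?rnorm_ge0 ?le_c0Z_norm.
apply/eqP; rewrite eq_le le/=.
have [->|a0] := eqVneq a 0.
  by rewrite rnorm0 mul0r (le_trans (rnorm_ge0 _) (le_c0Z_norm _ 0)).
have ra0 : 0 < rnorm (a : K^o).
  rewrite lt_neqAle rnorm_ge0 eq_sym andbT; apply: contra_neq a0.
  exact: (@rnorm_eq0 _ _ K^o).
rewrite mulrC -ler_pdivlMr// mulrC -{1}[x](scalerK a0) (le_trans (le _ _))//.
rewrite ler_wpM2r ?(le_trans (rnorm_ge0 _) (le_c0Z_norm _ 0))//.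
rewrite -(@ler_pM2r _ (rnorm (a : K^o)))// mulVf ?gt_eqF//.
rewrite -(rnormZ (V := K^o)) [_ *: _]mulVf// /rnorm normr1.
by rewrite -(@of_realK R k 1) /of_real; case: (k).
Qed.

Let knorm_eq0 (x : c0Z) : knorm x = 0 -> x = 0.
Proof.
move=> /(congr1 (@real_of R k)); rewrite of_realK -(of_real0 R k) of_realK => x0.
apply/val_inj/funext => i; apply: rnorm_eq0; apply/eqP.
by rewrite eq_le rnorm_ge0 andbT -x0 le_c0Z_norm.
Qed.

HB.instance Definition _ :=
  @Lmodule_isNormed.Build K c0Z knorm ler_knormD knormZ knorm_eq0.

Lemma c0Z_rnormE (x : c0Z) : rnorm x = c0Z_norm x.
Proof. by rewrite /rnorm of_realK. Qed.

Lemma c0Z_complete (F : set_system c0Z) :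
  ProperFilter F -> cauchy F -> cvg F.
Proof.
move=> FF Fc.
have evle (x y : c0Z) i : rnorm (x i - y i) <= rnorm (x - y).
  by rewrite c0Z_rnormE; exact: (le_c0Z_norm (x - y)).
have [l Fl] := cauchy_coord evle Fc.
have key (e : R) : 0 < e -> exists2 A, F A &
    forall x, A x -> forall i, rnorm (l i - x i) <= e.
  move=> e0; have e20 : 0 < e / 2 by rewrite divr_gt0.
  have [A FA Ae] := cauchy_rnorm Fc e20; exists A => // x Ax i.
  have Fli : F [set x | rnorm (l i - x i) <= e / 2].
    exact: (cvg_rnorm (Fl i) e20).
  have [y [Ay ly]] := filter_ex (filterI FA Fli).
  rewrite (splitr e) -[l i - x i](subrKA (y i)).
  rewrite (le_trans (ler_rnormD _ _))// lerD//.
  exact: le_trans (evle _ _ _) (Ae _ _ Ay Ax).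
have lP : l \in c0Z_pred.
  apply/asboolP => e e0; have e20 : 0 < e / 2 by rewrite divr_gt0.
  have [A FA Ae] := key _ e20; have [x Ax] := filter_ex FA.
  have /asboolP/(_ _ e20)[N xN] := c0Z_seqP x.
  exists N => i /xN xi; rewrite (splitr e) -[l i](subrK (x i)).
  by rewrite (le_lt_trans (ler_rnormD _ _))// ler_ltD// Ae.
apply/cvg_ex; exists (C0Z lP); apply: cvg_rnormP => e e0.
have [A FA Ae] := key _ e0; apply: filterS FA => x Ax.
by rewrite c0Z_rnormE; apply/c0Z_norm_le => i; exact: Ae.
Qed.

HB.instance Definition _ := Uniform_isComplete.Build c0Z c0Z_complete.

End c0Z.
Arguments c0Z_pred {R k} X _.

Section powR_sums.
Context (R : realType) (p : R) (hp : 1 <= p).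
Implicit Types f g h : int -> R.

Let p_ge0 : 0 <= p. Proof. exact: le_trans hp. Qed.

Let p_neq0 : p != 0. Proof. by rewrite gt_eqF// (lt_le_trans _ hp). Qed.

Lemma powR_convex_comb (w x y : R) : 0 <= w <= 1 -> 0 <= x -> 0 <= y ->
  (w * x + (1 - w) * y) `^ p <= w * x `^ p + (1 - w) * y `^ p.
Proof.
move=> /andP[w0 w1] x0 y0.
by apply: (convex_powR hp (Itv01 w0 w1)); rewrite inE/= in_itv/= andbT.
Qed.

Definition psum_le f r :=
  forall s : seq int, uniq s -> \sum_(i <- s) f i `^ p <= r `^ p.

Lemma psum_le_esum f r :
  psum_le f r <-> (\esum_(i in [set: int]) (f i `^ p)%:E <= (r `^ p)%:E)%E.
Proof.
split=> [fr|fr s us].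
  apply: ge_ereal_sup => _ [D [fD _] <-].
  by rewrite fsbig_finite//= sumEFin lee_fin fr// fset_uniq.
rewrite -lee_fin (le_trans _ fr)//; apply: ereal_sup_ubound.
exists [set` s]; first by split => //; exact: finite_seq.
by rewrite -fsbig_seq// sumEFin.
Qed.

Lemma psum_summable f r :
  psum_le f r -> summable [set: int] (fun i => (f i `^ p)%:E).
Proof.
move=> /psum_le_esum fr; rewrite /summable; apply: (@le_lt_trans _ _ (r `^ p)%:E).
  by under eq_esum => i _ do rewrite /= ger0_norm ?powR_ge0//.
exact: ltry.
Qed.

Definition pnorm f : R :=
  (fine (\esum_(i in [set: int]) (f i `^ p)%:E)) `^ p^-1.

Lemma pnorm_ge0 f : 0 <= pnorm f. Proof. exact: powR_ge0. Qed.

Let summable_fin f : summable [set: int] (fun i => (f i `^ p)%:E) ->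
  \esum_(i in [set: int]) (f i `^ p)%:E \is a fin_num.
Proof.
rewrite summableE; congr (_ \is a fin_num).
by apply: eq_esum => i _; rewrite /= ger0_norm ?powR_ge0.
Qed.

Lemma pnorm_le f r : summable [set: int] (fun i => (f i `^ p)%:E) -> 0 <= r ->
  pnorm f <= r <-> psum_le f r.
Proof.
move=> /summable_fin sf r0.
have e0 : (0 <= \esum_(i in [set: int]) (f i `^ p)%:E)%E.
  by apply: esum_ge0 => i _; rewrite lee_fin powR_ge0.
have F0 := fine_ge0 e0.
split=> [fr|/psum_le_esum].
  apply/psum_le_esum; rewrite -(fineK sf) lee_fin.
  have := ge0_ler_powR p_ge0 (pnorm_ge0 f) r0 fr.
  by rewrite -powRrM mulVf// powRr1.
rewrite -{1}(fineK sf) lee_fin => fr.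
have ip0 : 0 <= p^-1 by rewrite invr_ge0.
have := ge0_ler_powR ip0 F0 (powR_ge0 r p) fr.
by rewrite -powRrM mulfV// powRr1.
Qed.

Lemma psum_pnorm f : summable [set: int] (fun i => (f i `^ p)%:E) ->
  psum_le f (pnorm f).
Proof. by move=> sf; apply/pnorm_le => //; exact: pnorm_ge0. Qed.

Lemma psum_coord f r i : 0 <= f i -> 0 <= r -> psum_le f r -> f i <= r.
Proof.
move=> f0 r0 /(_ [:: i] isT); rewrite big_seq1 => fr.
have ip0 : 0 <= p^-1 by rewrite invr_ge0.
have := ge0_ler_powR ip0 (powR_ge0 (f i) p) (powR_ge0 r p) fr.
by rewrite -!powRrM mulfV// !powRr1.
Qed.

Lemma psum_le_trans f r r' : 0 <= r -> r <= r' -> psum_le f r -> psum_le f r'.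
Proof.
move=> r0 rr' fr s us; rewrite (le_trans (fr s us))//.
by rewrite (ge0_ler_powR p_ge0)// nnegrE// (le_trans r0).
Qed.

Lemma psum_leZ f c r : (forall i, 0 <= f i) -> 0 <= c -> 0 <= r ->
  psum_le f r -> psum_le (fun i => c * f i) (c * r).
Proof.
move=> f0 c0 r0 fr s us; rewrite powRM//.
rewrite (eq_bigr (fun i => c `^ p * f i `^ p)) => [|i _]; last by rewrite powRM.
by rewrite -mulr_sumr ler_wpM2l ?powR_ge0 ?fr.
Qed.

Lemma psum_le_homo f g r : (forall i, 0 <= f i <= g i) ->
  psum_le g r -> psum_le f r.
Proof.
move=> fg gr s us; rewrite (le_trans _ (gr s us))//; apply: ler_sum => i _.
have /andP[f0 fg'] := fg i.
by rewrite (ge0_ler_powR p_ge0)// nnegrE// (le_trans f0).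
Qed.

Lemma minkowski_seq f g (s : seq int) (a b : R) :
  (forall i, 0 <= f i) -> (forall i, 0 <= g i) -> 0 < a -> 0 < b ->
  \sum_(i <- s) f i `^ p <= a `^ p -> \sum_(i <- s) g i `^ p <= b `^ p ->
  \sum_(i <- s) (f i + g i) `^ p <= (a + b) `^ p.
Proof.
move=> f0 g0 a0 b0 fa gb; have ab0 : 0 < a + b by rewrite addr_gt0.
pose w := a / (a + b).
have w01 : 0 <= w <= 1.
  by rewrite (divr_ge0 (ltW a0) (ltW ab0))/= ler_pdivrMr// mul1r lerDl ltW.
have wE : 1 - w = b / (a + b).
  by rewrite /w -{1}(divff (lt0r_neq0 ab0)) -mulrBl addrAC subrr add0r.
have step i : (f i + g i) `^ p <= (a + b) `^ p *
    (w * (f i `^ p / a `^ p) + (1 - w) * (g i `^ p / b `^ p)).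
  have -> : f i + g i = (a + b) * (w * (f i / a) + (1 - w) * (g i / b)).
    by rewrite wE /w; field; rewrite !lt0r_neq0.
  have fa0 : 0 <= f i / a by rewrite divr_ge0// ltW.
  have gb0 : 0 <= g i / b by rewrite divr_ge0// ltW.
  have /andP[w0 w1] := w01.
  rewrite powRM ?(ltW ab0)//; last by rewrite addr_ge0// mulr_ge0// subr_ge0.
  rewrite ler_wpM2l ?powR_ge0// (le_trans (powR_convex_comb w01 fa0 gb0))//.
  have powR_div (x y : R) : 0 <= x -> 0 < y -> (x / y) `^ p = x `^ p / y `^ p.
    move=> x0 y0; rewrite powRM ?invr_ge0 ?(ltW y0)//.
    by rewrite -(powR_inv1 (ltW y0)) -powRrM mulN1r powRN.
  by rewrite !powR_div.
apply: (le_trans (ler_sum _ (fun i _ => step i))).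
rewrite -mulr_sumr -[leRHS]mulr1 ler_wpM2l ?powR_ge0// big_split/=.
have /andP[w0 w1] := w01.
rewrite -!mulr_sumr -!mulr_suml -[leRHS](subrKC w) lerD//.
  by rewrite ler_piMr// ler_pdivrMr ?powR_gt0// mul1r.
by rewrite ler_piMr ?subr_ge0// ler_pdivrMr ?powR_gt0// mul1r.
Qed.

Lemma minkowski_psum f g (a b : R) :
  (forall i, 0 <= f i) -> (forall i, 0 <= g i) -> 0 < a -> 0 < b ->
  psum_le f a -> psum_le g b -> psum_le (fun i => f i + g i) (a + b).
Proof. by move=> *; move=> s us; apply: minkowski_seq => //; auto. Qed.

Lemma psum_small (s : seq int) (e : R) : 0 < e -> exists2 d, 0 < d &
  forall f, (forall i, 0 <= f i) -> (forall i, i \in s -> f i <= d) ->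
  \sum_(i <- s) f i `^ p <= e `^ p.
Proof.
move=> e0; have n0 : 0 < (size s).+1%:R^-1 :> R by rewrite invr_gt0.
exists ((size s).+1%:R^-1 * e) => [|f f0 fs]; first by rewrite mulr_gt0.
have bnd i : i \in s -> f i `^ p <= (size s).+1%:R^-1 * e `^ p.
  move=> /fs fi; apply: (@le_trans _ _ (((size s).+1%:R^-1 * e) `^ p)).
    by rewrite (ge0_ler_powR p_ge0)// nnegrE// mulr_ge0// ltW.
  by rewrite ge1r_powRZ ?(ltW e0)// n0 invf_le1 ?ltr0n// ler1n.
rewrite big_seq (le_trans (ler_sum _ bnd))// -big_seq.
rewrite big_const_seq count_predT iter_addr_0 -[_ *+ size s]mulr_natl mulrA.
by rewrite ler_piMl ?powR_ge0// ler_pdivrMr ?ltr0n// mul1r ler_nat.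
Qed.

End powR_sums.

(* The Banach space l^p(X, Z), 1 <= p < +oo. *)
Section lpZ_pred.
Context (R : realType) (k : scalar_kind)
  (X : completeNormedModType (scalar_field R k)).
Context (p : R) (hp : 1 <= p).
Local Notation K := (scalar_field R k).

Definition lpZ_pred : {pred int -> X} := fun x =>
  summable [set: int] (fun i => (rnorm (x i) `^ p)%:E).

Lemma lpZ_predP (x : int -> X) :
  x \in lpZ_pred <-> exists2 r : R, 0 < r & psum_le p (rnorm \o x) r.
Proof.
split=> [xp|[r r0 xr]]; last exact: psum_summable xr.
exists (pnorm p (rnorm \o x) + 1); first by rewrite ltr_wpDl// pnorm_ge0.
by apply: psum_le_trans (psum_pnorm hp xp); rewrite ?pnorm_ge0// lerDl.
Qed.

Lemma lpZ_submod_closed : submod_closed lpZ_pred.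
Proof.
split.
  apply/lpZ_predP; exists 1 => // s us.
  rewrite big1 ?powR_ge0// => i _.
  by rewrite /= rnorm0 powR0// gt_eqF// (lt_le_trans _ hp).
move=> a x y /lpZ_predP[r r0 xr] /lpZ_predP[t t0 yt].
have c0 : 0 < rnorm (a : K^o) + 1 by rewrite ltr_wpDl// rnorm_ge0.
apply/lpZ_predP; exists ((rnorm (a : K^o) + 1) * r + t).
  by rewrite addr_gt0// mulr_gt0.
have nx i : 0 <= (rnorm \o x) i by exact: rnorm_ge0.
have ny i : 0 <= (rnorm \o y) i by exact: rnorm_ge0.
have cx i : 0 <= (rnorm (a : K^o) + 1) * (rnorm \o x) i by rewrite mulr_ge0// ltW.
have := minkowski_psum hp cx ny (mulr_gt0 c0 r0) t0
  (psum_leZ nx (ltW c0) (ltW r0) xr) yt.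
apply: psum_le_homo => // i; rewrite rnorm_ge0/=.
rewrite (le_trans (ler_rnormD _ _))// lerD2r rnormZ ler_wpM2r ?rnorm_ge0//.
by rewrite lerDl.
Qed.

End lpZ_pred.
Arguments lpZ_pred {R k} X p _.

Record lpZ (R : realType) (k : scalar_kind)
    (X : completeNormedModType (scalar_field R k)) (p : R) (hp : 1 <= p) :=
  LpZ { lpZ_seq :> int -> X ; lpZ_seqP : lpZ_seq \in lpZ_pred X p }.
Arguments LpZ {R k X p} hp {lpZ_seq}.

Section lpZ_normed.
Context (R : realType) (k : scalar_kind)
  (X : completeNormedModType (scalar_field R k)).
Context (p : R) (hp : 1 <= p).
Local Notation K := (scalar_field R k).
Local Notation lp := (lpZ X hp).

HB.instance Definition _ := GRing.isSubmodClosed.Build _ _ (lpZ_pred X p)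
  (lpZ_submod_closed X hp).

HB.instance Definition _ := [isSub for @lpZ_seq R k X p hp].
HB.instance Definition _ := [Choice of lp by <:].
HB.instance Definition _ := [SubChoice_isSubLmodule of lp by <:].

Definition lpZ_norm (x : lp) : R :=
  (fine (\esum_(i in [set: int]) (rnorm (x i) `^ p)%:E)) `^ p^-1.

Lemma lpZ_norm_ge0 (x : lp) : 0 <= lpZ_norm x.
Proof. exact: powR_ge0. Qed.

Lemma lpZ_norm_le (x : lp) r : 0 <= r ->
  lpZ_norm x <= r <-> psum_le p (rnorm \o x) r.
Proof. exact: (pnorm_le hp (lpZ_seqP x)). Qed.

Lemma psum_lpZ_norm (x : lp) : psum_le p (rnorm \o x) (lpZ_norm x).
Proof. by apply/lpZ_norm_le => //; exact: lpZ_norm_ge0. Qed.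

Lemma le_lpZ_norm (x : lp) i : rnorm (x i) <= lpZ_norm x.
Proof.
apply: (psum_coord hp (f := rnorm \o x) (rnorm_ge0 _) (lpZ_norm_ge0 x)).
exact: psum_lpZ_norm.
Qed.

Let knorm (x : lp) : K := of_real k (lpZ_norm x).

Let ler_knormD (x y : lp) : knorm (x + y) <= knorm x + knorm y.
Proof.
rewrite /knorm -of_realD ler_of_real; apply/ler_addgt0Pr => e e0.
have e20 : 0 < e / 2 by rewrite divr_gt0.
have pos (z : lp) : 0 < lpZ_norm z + e / 2 by rewrite ltr_wpDl// lpZ_norm_ge0.
have bnd (z : lp) : psum_le p (rnorm \o z) (lpZ_norm z + e / 2).
  apply: psum_le_trans (psum_lpZ_norm z) => //; first exact: lpZ_norm_ge0.
  by rewrite lerDl ltW.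
have nn (z : lp) i : 0 <= (rnorm \o z) i by exact: rnorm_ge0.
rewrite (splitr e) addrACA; apply/lpZ_norm_le; first by rewrite addr_ge0// ltW.
have := minkowski_psum hp (nn x) (nn y) (pos x) (pos y) (bnd x) (bnd y).
by apply: psum_le_homo => // i; rewrite rnorm_ge0/= ler_rnormD.
Qed.

Let knormZ a (x : lp) : knorm (a *: x) = `|a| * knorm x.
Proof.
rewrite (rnormE (a : K^o)) /knorm -of_realM; congr (of_real _ _).
have le b (y : lp) : lpZ_norm (b *: y) <= rnorm (b : K^o) * lpZ_norm y.
  apply/lpZ_norm_le; first by rewrite mulr_ge0 ?rnorm_ge0 ?lpZ_norm_ge0.
  have nn i : 0 <= (rnorm \o y) i by exact: rnorm_ge0.
  have := psum_leZ nn (rnorm_ge0 (b : K^o)) (lpZ_norm_ge0 y) (psum_lpZ_norm y).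
  by apply: psum_le_homo => // i; rewrite rnorm_ge0/= rnormZ.
apply/eqP; rewrite eq_le le/=.
have [->|a0] := eqVneq a 0; first by rewrite rnorm0 mul0r lpZ_norm_ge0.
have ra0 : 0 < rnorm (a : K^o).
  rewrite lt_neqAle rnorm_ge0 eq_sym andbT; apply: contra_neq a0.
  exact: (@rnorm_eq0 _ _ K^o).
rewrite mulrC -ler_pdivlMr// mulrC -{1}[x](scalerK a0) (le_trans (le _ _))//.
rewrite ler_wpM2r ?lpZ_norm_ge0//.
rewrite -(@ler_pM2r _ (rnorm (a : K^o)))// mulVf ?gt_eqF//.
rewrite -(rnormZ (V := K^o)) [_ *: _]mulVf// /rnorm normr1.
by rewrite -(@of_realK R k 1) /of_real; case: (k).
Qed.

Let knorm_eq0 (x : lp) : knorm x = 0 -> x = 0.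
Proof.
move=> /(congr1 (@real_of R k)); rewrite of_realK -(of_real0 R k) of_realK => x0.
apply/val_inj/funext => i; apply: rnorm_eq0; apply/eqP.
by rewrite eq_le rnorm_ge0 andbT -x0 le_lpZ_norm.
Qed.

HB.instance Definition _ :=
  @Lmodule_isNormed.Build K lp knorm ler_knormD knormZ knorm_eq0.

Lemma lpZ_rnormE (x : lp) : rnorm x = lpZ_norm x.
Proof. by rewrite /rnorm of_realK. Qed.

Lemma lpZ_complete (F : set_system lp) :
  ProperFilter F -> cauchy F -> cvg F.
Proof.
move=> FF Fc.
have evle (x y : lp) i : rnorm (x i - y i) <= rnorm (x - y).
  by rewrite lpZ_rnormE; exact: (le_lpZ_norm (x - y)).
have [l Fl] := cauchy_coord evle Fc.
have key (e : R) : 0 < e -> exists2 A, F A &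
    forall x, A x -> psum_le p (fun i => rnorm (l i - x i)) e.
  move=> e0; have e20 : 0 < e / 2 by rewrite divr_gt0.
  have [A FA Ae] := cauchy_rnorm Fc e20; exists A => // x Ax s us.
  have [d d0 sd] := psum_small hp s e20.
  have Fli : F (\bigcap_(i in [set` [fset i in s]%fset])
      [set y : lp | rnorm (l i - y i) <= d]).
    by apply: filter_bigI => i _; exact: (cvg_rnorm (Fl i) d0).
  have [y [Ay ly]] := filter_ex (filterI FA Fli).
  have n1 i : 0 <= rnorm (l i - y i) by exact: rnorm_ge0.
  have n2 i : 0 <= (rnorm \o (y - x : lp)) i by exact: rnorm_ge0.
  have s1 : \sum_(i <- s) rnorm (l i - y i) `^ p <= (e / 2) `^ p.
    by apply: sd => // i si; apply: ly; rewrite /= inE.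
  have s2 : \sum_(i <- s) (rnorm \o (y - x : lp)) i `^ p <= (e / 2) `^ p.
    suff : psum_le p (rnorm \o (y - x : lp)) (e / 2) by apply.
    by apply/lpZ_norm_le; [exact: ltW|rewrite -lpZ_rnormE Ae].
  have := minkowski_seq hp n1 n2 e20 e20 s1 s2; rewrite -splitr.
  apply: le_trans; apply: ler_sum => i _.
  rewrite ge0_ler_powR ?nnegrE ?addr_ge0 ?rnorm_ge0 ?(le_trans _ hp)//.
  by rewrite -[l i - x i](subrKA (y i)) ler_rnormD.
have lP : l \in lpZ_pred X p.
  have [A FA Ae] := key _ ltr01; have [x Ax] := filter_ex FA.
  have /(lpZ_predP hp)[r r0 xr] := lpZ_seqP x.
  apply/(lpZ_predP hp); exists (1 + r); first by rewrite addr_gt0.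
  have n1 i : 0 <= rnorm (l i - x i) by exact: rnorm_ge0.
  have n2 i : 0 <= (rnorm \o x) i by exact: rnorm_ge0.
  have := minkowski_psum hp n1 n2 ltr01 r0 (Ae _ Ax) xr.
  apply: psum_le_homo => // i; rewrite rnorm_ge0/=.
  by rewrite -{1}[l i](subrK (x i)) ler_rnormD.
apply/cvg_ex; exists (LpZ hp lP); apply: cvg_rnormP => e e0.
have [A FA Ae] := key _ e0; apply: filterS FA => x Ax.
by rewrite lpZ_rnormE; apply/lpZ_norm_le; [exact: ltW|exact: Ae].
Qed.

HB.instance Definition _ := Uniform_isComplete.Build lp lpZ_complete.

End lpZ_normed.

(* B_T (x_i)_i = (T x_(i+1))_i. Boundedness of T is what makes B_T x a member
   of the sequence space. *)
Section backward_shift.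
Context (R : realType) (k : scalar_kind)
  (X : completeNormedModType (scalar_field R k)).
Variables (T : {linear X -> X}) (bT : bounded_near T (nbhs (0 : X))).

Definition shift_seq (x : int -> X) : int -> X := fun i => T (x (i + 1)).

Lemma c0Z_shift (x : c0Z X) : shift_seq x \in c0Z_pred X.
Proof.
have [M M0 TM] := linear_rnorm_bounded bT.
have /asboolP x0 := c0Z_seqP x.
apply/asboolP => e e0; have [N xN] := x0 (e / M) (divr_gt0 e0 M0).
exists N.+1 => i iN; rewrite (le_lt_trans (TM _))// mulrC -ltr_pdivlMr//.
by apply: xN; lia.
Qed.

Lemma lpZ_shift (p : R) (hp : 1 <= p) (x : lpZ X hp) :
  shift_seq x \in lpZ_pred X p.
Proof.
have [M M0 TM] := linear_rnorm_bounded bT.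
have /(lpZ_predP hp)[r r0 xr] := lpZ_seqP x.
apply/(lpZ_predP hp); exists (M * r); first by rewrite mulr_gt0.
have nn i : 0 <= rnorm (x (i + 1)) by exact: rnorm_ge0.
have x1r : psum_le p (fun i => rnorm (x (i + 1))) r.
  move=> s us; have := xr [seq i + 1 | i <- s]; rewrite big_map; apply.
  by rewrite map_inj_uniq//; exact: addIr.
have := psum_leZ nn (ltW M0) (ltW r0) x1r.
by apply: psum_le_homo => // i; rewrite rnorm_ge0/= TM.
Qed.

Definition B_c0 (x : c0Z X) : c0Z X := C0Z (c0Z_shift x).

Definition B_lp (p : R) (hp : 1 <= p) (x : lpZ X hp) : lpZ X hp :=
  LpZ hp (lpZ_shift x).

Lemma B_c0_is_linear : linear B_c0.
Proof. by move=> a x y; apply/val_inj/funext => i; exact: linearP. Qed.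

HB.instance Definition _ :=
  GRing.isLinear.Build (scalar_field R k) (c0Z X) (c0Z X) _ B_c0 B_c0_is_linear.

Lemma B_lp_is_linear (p : R) (hp : 1 <= p) : linear (@B_lp p hp).
Proof. by move=> a x y; apply/val_inj/funext => i; exact: linearP. Qed.

HB.instance Definition _ (p : R) (hp : 1 <= p) :=
  GRing.isLinear.Build (scalar_field R k) (lpZ X hp) (lpZ X hp) _ (@B_lp p hp)
    (@B_lp_is_linear p hp).

Lemma B_c0_bounded : bounded_near B_c0 (nbhs (0 : c0Z X)).
Proof.
have [M M0 TM] := linear_rnorm_bounded bT.
apply/rnorm_bounded_linear; exists M => // x.
rewrite !c0Z_rnormE; apply/c0Z_norm_le => i.
by rewrite (le_trans (TM _))// ler_wpM2l ?(ltW M0) ?le_c0Z_norm.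
Qed.

Lemma B_lp_bounded (p : R) (hp : 1 <= p) :
  bounded_near (@B_lp p hp) (nbhs (0 : lpZ X hp)).
Proof.
have [M M0 TM] := linear_rnorm_bounded bT.
apply/rnorm_bounded_linear; exists M => // x.
rewrite !lpZ_rnormE; apply/lpZ_norm_le.
  by rewrite mulr_ge0 ?(ltW M0) ?lpZ_norm_ge0.
have nn i : 0 <= rnorm (x (i + 1)) by exact: rnorm_ge0.
have x1 : psum_le p (fun i => rnorm (x (i + 1))) (lpZ_norm x).
  move=> s us; have := psum_lpZ_norm x; move=> /(_ [seq i + 1 | i <- s]).
  by rewrite big_map; apply; rewrite map_inj_uniq//; exact: addIr.
have := psum_leZ nn (ltW M0) (lpZ_norm_ge0 x) x1.
by apply: psum_le_homo => // i; rewrite rnorm_ge0/= TM.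
Qed.

End backward_shift.
Arguments B_lp {R k X T} bT {p} hp x.

Definition hypercyclic (Y : topologicalType) (S : Y -> Y) :=
  exists y : Y, dense (range (fun n => iter n S y)).

Definition dsum (Y : Type) (S : Y -> Y) : Y * Y -> Y * Y :=
  fun yz => (S yz.1, S yz.2).

Definition weakly_mixing (Y : topologicalType) (S : Y -> Y) :=
  hypercyclic (dsum S).

(* Main.v *)
(* By Birkhoff's transitivity theorem, hypercyclicity of a continuous operator on
   a separable Banach space amounts to topological transitivity.

   If B_T is hypercyclic, it maps some y close to a sequence supported on {0, 1},
   with values u1, u2, to one close to a sequence supported on {2, 3}, with values
   v1, v2, after some n >= 0 steps. Since n >= 0, the coordinates y_0, y_1 are
   sent by T^n to small vectors and y_(n+2), y_(n+3) are small, so that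
   y_0 + y_(n+2) and y_1 + y_(n+3) are close to u1 and u2, and are mapped by T^n
   close to v1 and v2: T (+) T is transitive.

   Conversely, if T is weakly mixing there are a vector x with dense T-orbit,
   and, for every e > 0, an n and a w such that w, T^n x and T^n w - x have norm
   less than e. Finite combinations of vectors T^a x put at various positions
   approximate all of Y (+) Y; adding to such a combination for the source one
   for the target, with x replaced by w and positions translated by n, shows that
   B_T (+) B_T is transitive. *)
From HB Require Import structures.
Require Import Defs.
From mathcomp Require Import all_boot all_order all_algebra.
From mathcomp Require Import all_classical all_reals all_analysis.
From mathcomp Require Import lra zify.

Set Implicit Arguments.
Unset Strict Implicit.
Unset Printing Implicit Defensive.

Import Order.TTheory GRing.Theory Num.Theory.
Import numFieldNormedType.Exports.

Local Open Scope classical_set_scope.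
Local Open Scope ring_scope.

(* The complete structure below needs the product to be seen as pointed at the
   uniform level, a join the library does not declare. *)
HB.instance Definition _ (K : numFieldType) (U V : normedModType K) :=
  Pointed.on (U * V)%type.

(** The Baire argument is run on direct sums, so the product of two Banach spaces has to be a Banach
    space. *)
Lemma prod_complete (K : numFieldType) (U V : completeNormedModType K)
    (F : set_system (U * V)) :
  ProperFilter F -> cauchy F -> cvg F.
Proof.
move=> FF Fc; have cF := (@cauchyP K _ F FF).1 Fc.
have [/cauchy_cvg/cvg_ex[l1 Fl1] /cauchy_cvg/cvg_ex[l2 Fl2]] :
    cauchy (fst @ F) /\ cauchy (snd @ F).
  by split; apply/cauchyP => e /cF[x xe]; [exists x.1|exists x.2];
    apply: (@filterS _ F _ _ _ _ xe) => y [].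
apply/cvg_ex; exists (l1, l2) => A [[/= B C] [/= /Fl1 FB /Fl2 FC] BCA].
rewrite /nbhs /= in FB FC *.
by apply: filterS (filterI FB FC) => -[x y] [Bx Cy]; exact: BCA.
Qed.

HB.instance Definition _ (K : numFieldType) (U V : completeNormedModType K) :=
  Uniform_isComplete.Build (U * V)%type (@prod_complete K U V).

Lemma invn_lt (R : archiRealFieldType) (e : R) :
  0 < e -> exists n : nat, n.+1%:R^-1 < e.
Proof.
move=> e0; exists (Num.truncn e^-1).
by rewrite invf_plt ?posrE// truncnS_gt.
Qed.

(** * Hypercyclicity and topological transitivity *)

Section normed_spaces.
Context (R : realType) (k : scalar_kind).
Local Notation K := (scalar_field R k).
Implicit Types V : normedModType K.

Lemma nbhs_rnormP V (x : V) (A : set V) :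
  nbhs x A <-> exists2 e : R, 0 < e & forall y, rnorm (y - x) < e -> A y.
Proof.
split=> [/nbhs_ballP[e /= e0 xA]|[e e0 xA]].
  exists (real_of e).
    by rewrite -(ltr_of_real k) real_ofK ?(ltW e0)// of_real0.
  move=> y yx; apply: xA; rewrite -ball_normE/= distrC rnormE.
  by rewrite -(real_ofK (ltW e0)) ltr_of_real.
apply/nbhs_ballP; exists (of_real k e) => /=.
  by rewrite -(of_real0 R k) ltr_of_real.
by move=> y; rewrite -ball_normE/= distrC rnormE ltr_of_real; exact: xA.
Qed.

Lemma dense_rnormP V (A : set V) :
  dense A <-> forall x (e : R), 0 < e -> exists2 y, A y & rnorm (y - x) < e.
Proof.
split=> [dA x e e0|dA O [x Ox] oO].
  have /dA : ([set y | rnorm (y - x) < e])° !=set0.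
    by exists x; apply/nbhs_rnormP; exists e.
  case/(_ (open_interior _)) => y [/interior_subset/= yx Ay].
  by exists y.
have /nbhs_rnormP[e e0 eO] : nbhs x O by exact: open_nbhs_nbhs.
by have [y Ay /eO Oy] := dA x e e0; exists y.
Qed.

Lemma continuous_rnorm V (W : normedModType K) (f : V -> W) x (e : R) :
  continuous f -> 0 < e ->
  exists2 d : R, 0 < d & forall y, rnorm (y - x) < d -> rnorm (f y - f x) < e.
Proof.
move=> /(_ x) cf e0.
have /cf/nbhs_rnormP[d d0 df] : nbhs (f x) [set y | rnorm (y - f x) < e].
  by apply/nbhs_rnormP; exists e.
by exists d.
Qed.

Lemma rnorm_pair_lt V (W : normedModType K) (z : V * W) (e : R) :
  rnorm z < e <-> rnorm z.1 < e /\ rnorm z.2 < e.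
Proof.
have -> : rnorm z = Num.max (rnorm z.1) (rnorm z.2).
  apply: etrans (of_realK k _); congr real_of.
  by rewrite [LHS]prod_normE !rnormE /Order.max ltr_of_real -fun_if.
by rewrite gt_max; split=> [/andP[]|[-> ->]].
Qed.

Lemma iter_continuous V (S : V -> V) n :
  continuous S -> continuous (iter n S).
Proof.
move=> cS; elim: n => [|n IH] x /=; first exact: cvg_id.
exact: (continuous_comp (IH x) (cS _)).
Qed.

Lemma dsum_continuous V (S : V -> V) : continuous S -> continuous (dsum S).
Proof.
move=> cS [x y]; apply: cvg_pair => /=.
  by apply: cvg_comp; [exact: cvg_fst|exact: cS].
by apply: cvg_comp; [exact: cvg_snd|exact: cS].
Qed.

Lemma iter_dsum V (S : V -> V) n z :
  iter n (dsum S) z = (iter n S z.1, iter n S z.2).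
Proof. by elim: n => [|n /= ->]; first case: z. Qed.

(** A nonzero space has no isolated point: some [v != z] lies near [x], and a small enough ball
    about [v] misses [z]. *)
Lemma dense_setD1 V (A : set V) (w z : V) :
  w != 0 -> dense A -> dense (A `\ z).
Proof.
move=> w0 dA; apply/dense_rnormP => x e e0.
have e20 : 0 < e / 2 by rewrite divr_gt0.
have [v [vx vz]] : exists v, rnorm (v - x) < e / 2 /\ v != z.
  have [->|xz] := eqVneq x z; last by exists x; rewrite subrr rnorm0.
  pose c := e / 3 / rnorm w.
  have rw0 : 0 < rnorm w.
    by rewrite lt_neqAle rnorm_ge0 andbT eq_sym; apply: contra_neq w0 => /rnorm_eq0.
  have c0 : 0 < c by rewrite divr_gt0// divr_gt0.
  exists (z + of_real k c *: w); split.
    have rc : rnorm (of_real k c : K^o) = c.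
      by rewrite -[RHS](of_realK k) /rnorm ger0_norm// -(of_real0 R k) ler_of_real ltW.
    rewrite addrAC subrr add0r rnormZ rc /c divfK ?gt_eqF//; lra.
  rewrite -subr_eq0 addrAC subrr add0r scaler_eq0 negb_or w0 andbT.
  by rewrite -(of_real0 R k) eq_le !ler_of_real -eq_le gt_eqF.
have rvz : 0 < rnorm (v - z).
  rewrite lt_neqAle rnorm_ge0 andbT eq_sym; apply: contra_neq vz => /rnorm_eq0.
  by move/eqP; rewrite subr_eq0 => /eqP.
have f0 : 0 < Num.min (e / 2) (rnorm (v - z)) by rewrite lt_min e20.
have [y Ay] := (dense_rnormP A).1 dA v _ f0.
rewrite lt_min => /andP[yv yvz]; exists y.
  by split=> // yz; move: yvz; rewrite yz rnormB ltxx.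
by rewrite -(subrKA v) (le_lt_trans (ler_rnormD _ _))// (splitr e) ltrD.
Qed.

(* Removing finitely many points preserves density unless the space is trivial,
   and then there is nothing to prove. *)
Lemma orbit_tail_dense V (S : V -> V) (z : V) :
  dense (range (fun n => iter n S z)) ->
  forall (a : nat) (u : V) (e : R), 0 < e ->
  exists2 n : nat, (a <= n)%N & rnorm (iter n S z - u) < e.
Proof.
move=> dz a u e e0; have [[w w0]|V0] := pselect (exists w : V, w != 0); last first.
  have zero v : v = 0 :> V by apply: contrapT => /eqP v0; apply: V0; exists v.
  by exists a => //; rewrite (zero (_ - _)) rnorm0.
suff /dense_rnormP/(_ u e e0)[_ [n /= an <-]] :
  dense ((fun n => iter n S z) @` [set n | (a <= n)%N]) by exists n.
elim: a => [|a IH].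
  by congr dense : dz; rewrite eqEsubset; split=> _ [n _ <-]; exists n.
apply/dense_rnormP => x f f0.
(* Deleting the single point [iter a S z] rules out [n = a]. *)
have [_ [[n /= an <-] na] nx] :=
  (dense_rnormP _).1 (dense_setD1 (iter a S z) w0 IH) x f f0.
exists (iter n S z) => //; exists n => //=.
by rewrite ltn_neqAle an andbT; apply: contra_not_neq na => ->.
Qed.

(** The usual transitivity for open sets, expressed with balls; one radius serves both balls since
    it may be shrunk. *)
Definition topologically_transitive V (S : V -> V) :=
  forall (u v : V) (e : R), 0 < e ->
  exists (n : nat) (y : V), rnorm (y - u) < e /\ rnorm (iter n S y - v) < e.

(** A dense orbit meets the ball about [u] at some time [a] and, its tails being dense, the ball
    about [v] at some time [b >= a]. *)
Lemma hypercyclic_transitive V (S : V -> V) :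
  hypercyclic S -> topologically_transitive S.
Proof.
move=> [z dz] u v e e0.
have [a _ au] := orbit_tail_dense dz 0 u e0.
have [b ab bv] := orbit_tail_dense dz a v e0.
by exists (b - a)%N, (iter a S z); rewrite -iterD subnK.
Qed.

(* The library's [Baire] is restricted to real scalars. *)
Lemma Baire_rnorm (V : completeNormedModType K) (F : (set V)^nat) :
  (forall i, open (F i) /\ dense (F i)) -> dense (\bigcap_i F i).
Proof.
move=> odF; apply/dense_rnormP => x e e0.
pose cb (q : V * R) := [set z | rnorm (z - q.1) <= q.2].
(* Nested closed balls: the next one has radius at most [1/(n+1)] and lies in the current ball and
   in [F n]. *)
have /choice[f fP] (nq : nat * (V * R)) : exists q', 0 < nq.2.2 ->
    [/\ 0 < q'.2, q'.2 <= nq.1.+1%:R^-1, cb q' `<=` cb nq.2 & cb q' `<=` F nq.1].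
  case: nq => n [a r] /=; have [r0|_] := ltP 0 r; last by exists (a, r).
  have [oF /dense_rnormP/(_ a (r / 2) (divr_gt0 r0 (ltr0n _ 2)))[b Fb ba]] := odF n.
  have /nbhs_rnormP[d d0 dF] : nbhs b (F n) by exact: open_nbhs_nbhs.
  (* [r / 2] keeps the new ball inside the old one; [d / 2] puts even the closed ball inside
     [F n]. *)
  pose r' := Num.min (Num.min (r / 2) (d / 2)) n.+1%:R^-1.
  exists (b, r') => _; split=> /=.
  - by rewrite !lt_min !divr_gt0//= invr_gt0.
  - by rewrite ge_min lexx orbT.
  - move=> z; rewrite /cb/= !le_min => /andP[/andP[zb _] _].
    by rewrite -(subrKA b) (le_trans (ler_rnormD _ _))// (splitr r) lerD// ltW.
  - move=> z; rewrite /cb/= !le_min => /andP[/andP[_ zb] _].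
    by apply: dF; lra.
pose q := fix q n := if n is m.+1 then f (m, q m) else (x, e / 2).
have q0 n : 0 < (q n).2.
  by elim: n => [|n IH] /=; [rewrite divr_gt0|case: (fP (n, q n) IH)].
have qS n : [/\ (q n.+1).2 <= n.+1%:R^-1, cb (q n.+1) `<=` cb (q n)
    & cb (q n.+1) `<=` F n] by case: (fP (n, q n) (q0 n)).
have qle n m : (n <= m)%N -> cb (q m) `<=` cb (q n).
  elim: m => [|m IH]; first by rewrite leqn0 => /eqP ->.
  rewrite leq_eqVlt => /predU1P[-> //|/IH]; apply: subset_trans.
  by case: (qS m).
have qq n : cb (q n) (q n).1 by rewrite /cb/= subrr rnorm0 ltW.
pose a n := (q n).1.
have /cvg_ex[l al] : cvg (a @ \oo).
  apply: cauchy_cvg; apply: rnorm_cauchy => d d0.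
  have [n nd] := invn_lt (divr_gt0 d0 (ltr0n R 2)).
  exists (cb (q n.+1)).
    by exists n.+1 => // m /= nm; exact: (qle _ _ nm) (qq m).
  move=> y z; rewrite /cb/= => yq zq; have [qn _ _] := qS n.
  rewrite -(subrKA (q n.+1).1) (le_trans (ler_rnormD _ _))//.
  have qd := le_trans qn (ltW nd).
  by rewrite (rnormB _ z) (splitr d) lerD// (le_trans _ qd).
(* The centres lie in [cb (q n)] from index [n] on, and this ball is closed. *)
have lq n : cb (q n) l.
  apply/ler_addgt0Pr => d d0.
  have [m [/= lm nm]] : exists m, rnorm (l - a m) <= d /\ (n <= m)%N.
    have lad : \forall m \near \oo, rnorm (l - a m) <= d by exact: cvg_rnorm al _ d0.
    by have [m [? ?]] := filter_ex (filterI lad (nbhs_infty_ge n)); exists m.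
  rewrite -[l - _](subrKA (a m)) (le_trans (ler_rnormD _ _))// addrC lerD//.
  exact: (qle _ _ nm) (qq m).
exists l => [i _|]; first by have [_ _] := qS i; apply; exact: lq.
by apply: le_lt_trans (lq 0%N) _ => /=; lra.
Qed.

(** Birkhoff: [G (j, m)], the points whose orbit comes within [1/(m+1)] of [d j], is open by
    continuity and dense by transitivity; a point common to these countably many sets has a dense
    orbit. *)
Lemma transitive_hypercyclic (V : completeNormedModType K) (S : V -> V)
    (J : countType) (d : J -> V) :
  continuous S -> dense (range d) -> topologically_transitive S -> hypercyclic S.
Proof.
move=> cS /dense_rnormP dd trS.
pose G (jm : J * nat) := \bigcup_n
  (iter n S @^-1` ([set z | rnorm (z - d jm.1) < jm.2.+1%:R^-1])°).
have ball_int (u z : V) (e : R) : rnorm (z - u) < e ->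
    ([set z | rnorm (z - u) < e])° z.
  move=> zu; apply/nbhs_rnormP; exists (e - rnorm (z - u)); first by rewrite subr_gt0.
  by move=> y yz /=; rewrite -(subrKA z) (le_lt_trans (ler_rnormD _ _))//; lra.
pose F i := if unpickle i is Some jm then G jm else setT.
have odF i : open (F i) /\ dense (F i).
  rewrite /F; case: unpickle => [[j m]|]; last first.
    split; first exact: openT.
    by apply/dense_rnormP => x e e0; exists x => //; rewrite subrr rnorm0.
  split.
    apply: bigcup_open => n _; apply: open_comp; last exact: open_interior.
    by move=> y _; exact: iter_continuous.
  apply/dense_rnormP => u e e0.
  have e'0 : 0 < Num.min e m.+1%:R^-1 by rewrite lt_min e0 invr_gt0 ltr0Sn.
  have [n [y []]] := trS u (d j) _ e'0; rewrite !lt_min => /andP[yu _] /andP[_ yd].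
  by exists y => //; exists n => //; exact: ball_int.
have /dense_rnormP/(_ 0 1 ltr01)[y Fy _] := Baire_rnorm odF.
exists y; apply/dense_rnormP => u e e0.
have e20 : 0 < e / 2 by rewrite divr_gt0.
have [_ [j _ <-] ju] := dd u _ e20.
have [m me] := invn_lt e20.
have /(_ I) := Fy (pickle (j, m)); rewrite /F pickleK.
move=> [n _ /interior_subset/= ny]; exists (iter n S y); first by exists n.
rewrite -(subrKA (d j)) (le_lt_trans (ler_rnormD _ _))// (splitr e) ltrD//.
exact: lt_trans ny me.
Qed.

End normed_spaces.

(** * Weak mixing of linear operators *)

Lemma iter_linearB (K : numFieldType) (V : lmodType K) (S : {linear V -> V}) n x y :
  iter n S (x - y) = iter n S x - iter n S y.
Proof. by elim: n => // n /= ->; rewrite linearB. Qed.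

Lemma iter_linearD (K : numFieldType) (V : lmodType K) (S : {linear V -> V}) n x y :
  iter n S (x + y) = iter n S x + iter n S y.
Proof. by elim: n => // n /= ->; rewrite linearD. Qed.

Section weak_mixing.
Context (R : realType) (k : scalar_kind).
Local Notation K := (scalar_field R k).

Lemma iter_rnorm_bounded (V : normedModType K) (S : {linear V -> V}) n :
  bounded_near S (nbhs 0) ->
  exists2 M : R, 0 < M & forall x, rnorm (iter n S x) <= M * rnorm x.
Proof.
move=> /linear_rnorm_bounded[M M0 SM]; exists (M ^+ n); first exact: exprn_gt0.
elim: n => [|n IH] x; first by rewrite mul1r.
by rewrite iterS (le_trans (SM _))// exprS -mulrA ler_wpM2l// ltW.
Qed.

Lemma dense_orbit_fst (V : normedModType K) (S : V -> V) (z : V * V) :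
  dense (range (fun n => iter n (dsum S) z)) ->
  dense (range (fun n => iter n S z.1)).
Proof.
move=> /dense_rnormP dz; apply/dense_rnormP => u e e0.
have [_ [n _ <-]] := dz (u, u) e e0; rewrite iter_dsum => /rnorm_pair_lt[/= zu _].
by exists (iter n S z.1) => //; exists n.
Qed.

Lemma weakly_mixing_hypercyclic (V : normedModType K) (S : V -> V) :
  weakly_mixing S -> hypercyclic S.
Proof. by move=> [z /dense_orbit_fst dz]; exists z.1. Qed.

(* If [(x, y)] is hypercyclic for [S (+) S], so is [(x, S^m y)], and [S^m y] can
   be taken small: this is the [w] below. *)
Lemma weakly_mixing_criterion (V : normedModType K) (S : {linear V -> V}) :
  bounded_near S (nbhs 0) -> weakly_mixing S ->
  exists2 x : V, dense (range (fun n => iter n S x)) &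
  forall e : R, 0 < e -> exists (n : nat) (w : V),
    [/\ rnorm w < e, rnorm (iter n S x) < e & rnorm (iter n S w - x) < e].
Proof.
move=> bS [[x y] dxy]; have dx := dense_orbit_fst dxy; exists x => // e e0.
move/dense_rnormP in dxy; have [_ [m _ <-]] := dxy (0, 0) e e0.
rewrite iter_dsum => /rnorm_pair_lt[/= _]; rewrite subr0 => ye.
have e20 : 0 < e / 2 by rewrite divr_gt0.
(* As [a >= m], [S^a x] is [S^m] of [S^(a-m) x]; once [S^n y] is near the latter, [S^n (S^m y)] is
   near [S^a x], hence near [x]. *)
have [a ma ax] := orbit_tail_dense dx m x e20.
have [M M0 SM] := iter_rnorm_bounded m bS.
have d0 : 0 < Num.min e (e / 2 / M) by rewrite lt_min e0 divr_gt0.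
have [_ [n _ <-]] := dxy (0, iter (a - m) S x) _ d0.
rewrite iter_dsum => /rnorm_pair_lt[/=]; rewrite subr0 !lt_min.
move=> /andP[xe _] /andP[_ yx]; exists n, (iter m S y); split=> //.
have -> : iter n S (iter m S y) = iter m S (iter n S y) by rewrite -!iterD addnC.
rewrite -(subrKA (iter a S x)) (le_lt_trans (ler_rnormD _ _))// (splitr e) ltrD//.
rewrite -(subnKC ma) iterD -iter_linearB (le_lt_trans (SM _))//.
by rewrite mulrC -ltr_pdivlMr.
Qed.

End weak_mixing.

(** * Weighted shifts on an abstract sequence space *)

Section shift_space.
Context (R : realType) (k : scalar_kind)
  (X Y : completeNormedModType (scalar_field R k))
  (T : {linear X -> X}) (B : {linear Y -> Y})
  (bT : bounded_near T (nbhs (0 : X))) (bB : bounded_near B (nbhs (0 : Y))).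
(** Evaluation of a coordinate and insertion of a vector at one position; the properties assumed
    here are shared by c_0 and l^p, so one proof treats both. *)
Context (ev : int -> {linear Y -> X}) (ins : int -> {linear X -> Y}).
Context (ev_le : forall i y, rnorm (ev i y) <= rnorm y).
Context (ins_le : forall i x, rnorm (ins i x) <= rnorm x).
Context (ev_ins : forall i j x, ev j (ins i x) = if j == i then x else 0).
Context (finite_approx : forall (y : Y) (e : R), 0 < e ->
  exists s : seq int, rnorm (\sum_(i <- s) ins i (ev i y) - y) < e).
Context (ev_B : forall i y, ev i (B y) = T (ev (i + 1) y)).
Context (B_ins : forall i x, B (ins i x) = ins (i - 1) (T x)).

Lemma ev_iterB n i y : ev i (iter n B y) = iter n T (ev (i + n%:Z) y).
Proof.
elim: n i => [|n IH] i /=; first by rewrite addr0.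
by rewrite ev_B IH; congr (T (iter n T (ev _ y))); lia.
Qed.

Lemma iterB_ins n i x : iter n B (ins i x) = ins (i - n%:Z) (iter n T x).
Proof.
elim: n => [|n IH] /=; first by rewrite subr0.
by rewrite IH B_ins; congr (ins _ _); lia.
Qed.

Lemma transitive_dsum_of_hypercyclic_shift :
  hypercyclic B -> topologically_transitive (dsum T).
Proof.
move=> /hypercyclic_transitive trB [u1 u2] [v1 v2] e e0.
have e20 : 0 < e / 2 by rewrite divr_gt0.
(* The supports are chosen so that no [n >= 0] shifts a coordinate of [v] onto
   one of [u]. *)
have [n [y [yu yv]]] := trB (ins 0 u1 + ins 1 u2) (ins 2 v1 + ins 3 v2) _ e20.
have uy i : rnorm (ev i y - ev i (ins 0 u1 + ins 1 u2)) < e / 2.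
  by rewrite -linearB (le_lt_trans _ yu).
have vy i : rnorm (iter n T (ev (i + n%:Z) y) - ev i (ins 2 v1 + ins 3 v2)) < e / 2.
  by rewrite -ev_iterB -linearB (le_lt_trans _ yv).
(* [T^n] maps [y_i] near entry [i - n] of the target, which is 0, and [y_(j+n)] is near entry
   [j + n] of the source, also 0: neither summand of [p] disturbs the other. *)
have key i j (a b : X) :
    ev i (ins 0 u1 + ins 1 u2) = a -> ev (i - n%:Z) (ins 2 v1 + ins 3 v2) = 0 ->
    ev j (ins 2 v1 + ins 3 v2) = b -> ev (j + n%:Z) (ins 0 u1 + ins 1 u2) = 0 ->
    let p := ev i y + ev (j + n%:Z) y in
    rnorm (p - a) < e /\ rnorm (iter n T p - b) < e.
  move=> <- i0 <- j0 /=; split.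
    have := uy (j + n%:Z); rewrite j0 subr0 => uj.
    by rewrite addrAC (le_lt_trans (ler_rnormD _ _))// (splitr e) ltrD.
  have := vy (i - n%:Z); rewrite i0 subr0 subrK => vi.
  by rewrite iter_linearD -addrA (le_lt_trans (ler_rnormD _ _))// (splitr e) ltrD.
have evD i a b z z' : ev i (ins a z + ins b z') =
    (if i == a then z else 0) + (if i == b then z' else 0).
  by rewrite linearD !ev_ins.
have [n0 n1 n2 n3] : [/\ (0 - n%:Z == 2) = false, (0 - n%:Z == 3) = false,
    (1 - n%:Z == 2) = false & (1 - n%:Z == 3) = false] by split; apply/eqP; lia.
have [m0 m1 m2 m3] : [/\ (2 + n%:Z == 0) = false, (2 + n%:Z == 1) = false,
    (3 + n%:Z == 0) = false & (3 + n%:Z == 1) = false] by split; apply/eqP; lia.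
have [||||pu1 pv1] := key 0 2 u1 v1; rewrite ?evD ?n0 ?n1 ?m0 ?m1 ?addr0//.
have [||||pu2 pv2] := key 1 3 u2 v2; rewrite ?evD ?n2 ?n3 ?m2 ?m3 ?addr0 ?add0r//.
exists n, (ev 0 y + ev (2 + n%:Z) y, ev 1 y + ev (3 + n%:Z) y).
by split; apply/rnorm_pair_lt; rewrite ?iter_dsum.
Qed.

Lemma weakly_mixing_of_hypercyclic_shift : hypercyclic B -> weakly_mixing T.
Proof.
move=> hB; have trT := transitive_dsum_of_hypercyclic_shift hB.
have [z /dense_rnormP dz] := hB.
(* Separability of [X * X]: entry 0 is a contraction of [Y] onto [X], so it carries the dense orbit
   of [z] to a countable dense set. *)
pose d (ij : nat * nat) := (ev 0 (iter ij.1 B z), ev 0 (iter ij.2 B z)).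
apply: (transitive_hypercyclic (d := d)) trT.
  exact/dsum_continuous/linear_bounded_continuous.
apply/dense_rnormP => -[u1 u2] e e0.
have approx u : exists n, rnorm (ev 0 (iter n B z) - u) < e.
  have [_ [n _ <-] nu] := dz (ins 0 u) e e0; exists n.
  have -> : u = ev 0 (ins 0 u) by rewrite ev_ins eqxx.
  by rewrite -linearB (le_lt_trans _ nu).
have [[i iu] [j ju]] := (approx u1, approx u2).
by exists (d (i, j)); [exists (i, j)|apply/rnorm_pair_lt].
Qed.

(* [B^n] translates [spread c L] by [-n] while acting on its argument by [T^n],
   so its norm is controlled independently of the position [c]. *)
Definition spread (c : int) (L : seq (int * nat)) (z : X) : Y :=
  \sum_(ia <- L) ins (ia.1 + c) (iter ia.2 T z).

Lemma spreadB c L z z' : spread c L (z - z') = spread c L z - spread c L z'.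
Proof.
rewrite /spread -sumrB; apply: eq_bigr => ia _.
by rewrite iter_linearB linearB.
Qed.

Lemma iterB_spread n c L z :
  iter n B (spread c L z) = spread (c - n%:Z) L (iter n T z).
Proof.
rewrite /spread; elim: L => [|ia L IH].
  by rewrite !big_nil; elim: n => // n /= ->; rewrite linear0.
rewrite !big_cons iter_linearD IH iterB_ins addrA; congr (ins _ _ + _).
by rewrite -!iterD addnC.
Qed.

Lemma spread_bounded L : exists2 C : R, 0 < C &
  forall c z, rnorm (spread c L z) <= C * rnorm z.
Proof.
elim: L => [|[i a] L [C C0 LC]].
  by exists 1 => // c z; rewrite /spread big_nil rnorm0 mul1r rnorm_ge0.
have [M M0 TM] := iter_rnorm_bounded a bT.
exists (M + C) => [|c z]; first exact: addr_gt0.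
rewrite /spread big_cons (le_trans (ler_rnormD _ _))// mulrDl lerD//; last exact: LC.
exact: le_trans (ins_le _ _) (TM _).
Qed.

(** [finite_approx] leaves finitely many entries; each is approximated by an orbit point [T^a x],
    the tolerance being halved at every entry. *)
Lemma spread_dense x : dense (range (fun n => iter n T x)) ->
  forall (y : Y) (e : R), 0 < e -> exists L, rnorm (spread 0 L x - y) < e.
Proof.
move=> /dense_rnormP dx y e e0; have e20 : 0 < e / 2 by rewrite divr_gt0.
have [s sy] := finite_approx y e20.
suff [L Ls] : exists L, rnorm (spread 0 L x - \sum_(i <- s) ins i (ev i y)) < e / 2.
  exists L; rewrite -(subrKA (\sum_(i <- s) ins i (ev i y))).
  by rewrite (le_lt_trans (ler_rnormD _ _))// (splitr e) ltrD.
elim: s (e / 2) e20 {sy} => [|i s IH] f f0.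
  by exists [::]; rewrite /spread !big_nil subrr rnorm0.
have f20 : 0 < f / 2 by rewrite divr_gt0.
have [L Ls] := IH _ f20; have [_ [a _ <-] ai] := dx (ev i y) _ f20.
exists ((i, a) :: L); rewrite /spread !big_cons/= addr0 opprD addrACA -linearB.
rewrite (le_lt_trans (ler_rnormD _ _))// (splitr f) ltrD//.
exact: le_lt_trans (ins_le _ _) ai.
Qed.

Lemma weakly_mixing_shift : weakly_mixing T -> weakly_mixing B.
Proof.
move=> /(weakly_mixing_criterion bT)[x dx crit].
have dY := spread_dense dx.
(* Finite lists over [int * nat] are countable, which yields a countable dense subset of [Y * Y]. *)
pose d (LM : seq (int * nat) * seq (int * nat)) := (spread 0 LM.1 x, spread 0 LM.2 x).
apply: (transitive_hypercyclic (d := d)).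
- exact/dsum_continuous/linear_bounded_continuous.
- apply/dense_rnormP => -[u1 u2] e e0.
  have [[L Lu] [M Mu]] := (dY u1 e e0, dY u2 e e0).
  by exists (d (L, M)); [exists (L, M)|apply/rnorm_pair_lt].
move=> [u1 u2] [v1 v2] e e0; have e30 : 0 < e / 3 by rewrite divr_gt0.
(* [f] depends on [L] and [M] but not on [n] or [w], so a single pair [n], [w] will serve both
   components. *)
have approx u v : exists L M (f : R), [/\ 0 < f & forall n w,
    rnorm w < f -> rnorm (iter n T x) < f -> rnorm (iter n T w - x) < f ->
    rnorm (spread 0 L x + spread n%:Z M w - u) < e /\
    rnorm (iter n B (spread 0 L x + spread n%:Z M w) - v) < e].
  have [[L Lu] [M Mv]] := (dY u _ e30, dY v _ e30).
  have [[C C0 LC] [D D0 MD]] := (spread_bounded L, spread_bounded M).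
  exists L, M, (Num.min (e / 3 / C) (e / 3 / D)); split.
    by rewrite lt_min !divr_gt0.
  move=> n w; rewrite !lt_min !ltr_pdivlMr// => /andP[_ wf] /andP[xf _] /andP[_ wx].
  split.
    have Mw := MD n%:Z w.
    by rewrite addrAC (le_lt_trans (ler_rnormD _ _))//; lra.
  (* [B^n] moves the source part to offset [-n], with the small argument [T^n x], and the target
     part back to offset 0, with argument [T^n w] close to [x]. *)
  rewrite iter_linearD !iterB_spread subrr sub0r.
  have Lx := LC (- n%:Z) (iter n T x).
  have Mw := MD 0 (iter n T w - x).
  rewrite spreadB in Mw.
  rewrite -addrA (le_lt_trans (ler_rnormD _ _))//.
  have := ler_rnormD (spread 0 M (iter n T w) - spread 0 M x) (spread 0 M x - v).
  rewrite subrKA => ?; lra.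
have [L1 [M1 [f1 [f10 LM1]]]] := approx u1 v1.
have [L2 [M2 [f2 [f20 LM2]]]] := approx u2 v2.
have [|n [w]] := crit (Num.min f1 f2); first by rewrite lt_min f10.
rewrite !lt_min => -[/andP[w1 w2] /andP[x1 x2] /andP[wx1 wx2]].
exists n, (spread 0 L1 x + spread n%:Z M1 w, spread 0 L2 x + spread n%:Z M2 w).
have [[? ?] [? ?]] := (LM1 n w w1 x1 wx1, LM2 n w w2 x2 wx2).
by split; apply/rnorm_pair_lt; rewrite ?iter_dsum.
Qed.

Lemma shift_tfae : [<-> hypercyclic B; weakly_mixing B; weakly_mixing T].
Proof.
tfae.
- by move=> /weakly_mixing_of_hypercyclic_shift/weakly_mixing_shift.
- by move=> /weakly_mixing_hypercyclic/weakly_mixing_of_hypercyclic_shift.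
- by move=> /weakly_mixing_shift/weakly_mixing_hypercyclic.
Qed.

End shift_space.

(** * The spaces c_0(X, Z) and l^p(X, Z) *)

Section single_coordinate.
Context (V : zmodType).

Definition single (i : int) (x : V) : int -> V :=
  fun j => if j == i then x else 0.

Lemma sum_single (s : seq int) (x : int -> V) j : uniq s ->
  \sum_(i <- s) single i (x i) j = if j \in s then x j else 0.
Proof.
move=> us; rewrite /single -big_mkcond/=.
have [js|js] := ifPn; last first.
  by rewrite big_seq_cond big1// => i /andP[is_ /eqP ji]; rewrite ji is_ in js.
rewrite (eq_bigl (pred1 j)); last by move=> i; rewrite /= eq_sym.
by rewrite -big_filter filter_pred1_uniq// big_seq1.
Qed.

End single_coordinate.

Lemma single_linear (K : pzRingType) (V : lmodType K) i (a : K) (x y : V) j :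
  single i (a *: x + y) j = a *: single i x j + single i y j.
Proof. by rewrite /single; case: ifP => // _; rewrite scaler0 addr0. Qed.

Section c0Z_model.
Context (R : realType) (k : scalar_kind)
  (X : completeNormedModType (scalar_field R k)).
Local Notation K := (scalar_field R k).

Definition c0Z_coord (i : int) (y : c0Z X) : X := y i.

Lemma c0Z_coord_is_linear i : linear (c0Z_coord i).
Proof. by []. Qed.

HB.instance Definition _ i :=
  GRing.isLinear.Build K (c0Z X) X _ (c0Z_coord i) (c0Z_coord_is_linear i).

Lemma single_c0Z i (x : X) : single i x \in c0Z_pred X.
Proof.
apply/asboolP => e e0; exists `|i|.+1%N => j ij; rewrite /single.
by case: eqP => [ji|_]; [rewrite ji ltnn in ij|rewrite rnorm0].
Qed.

Definition c0Z_single i x : c0Z X := C0Z (single_c0Z i x).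

Lemma c0Z_single_is_linear i : linear (c0Z_single i).
Proof. by move=> a x y; apply/val_inj/funext => j; exact: single_linear. Qed.

HB.instance Definition _ i :=
  GRing.isLinear.Build K X (c0Z X) _ (c0Z_single i) (c0Z_single_is_linear i).

Lemma c0Z_finite_approx (y : c0Z X) (e : R) : 0 < e ->
  exists s : seq int, rnorm (\sum_(i <- s) c0Z_single i (c0Z_coord i y) - y) < e.
Proof.
move=> e0; have e20 : 0 < e / 2 by rewrite divr_gt0.
have /asboolP/(_ _ e20)[N yN] := c0Z_seqP y.
(* All integers of absolute value below [N]; [undup] removes the repeated 0. *)
pose s := undup ([seq n%:Z | n <- iota 0 N] ++ [seq - n%:Z | n <- iota 0 N]).
have sP j : j \notin s -> (N <= `|j|)%N.
  apply: contraNT; rewrite -ltnNge => jN; rewrite mem_undup mem_cat.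
  case: (intP j) jN => [|n|n] jN; apply/orP; [left|left|right].
  - by apply/mapP; exists 0%N; rewrite // mem_iota.
  - by apply/mapP; exists n.+1; rewrite // mem_iota; lia.
  - by apply/mapP; exists n.+1; rewrite // mem_iota; lia.
exists s; apply: (@le_lt_trans _ _ (e / 2)); last by rewrite ltr_pdivrMr// ltr_pMr// ltr1n.
rewrite c0Z_rnormE; apply/c0Z_norm_le => j.
rewrite -[X in rnorm X]/(c0Z_coord j _) linearB linear_sum/=.
have := sum_single y j (undup_uniq _ : uniq s); rewrite /c0Z_coord /= => ->.
case: ifPn => [_|/sP/yN/ltW]; first by rewrite subrr rnorm0 ltW.
by rewrite sub0r rnormN.
Qed.

Lemma c0Z_shift_tfae (T : {linear X -> X}) (bT : bounded_near T (nbhs 0)) :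
  [<-> hypercyclic (B_c0 bT); weakly_mixing (B_c0 bT); weakly_mixing T].
Proof.
apply: (@shift_tfae R k X (c0Z X) T (B_c0 bT) bT (B_c0_bounded bT)
  c0Z_coord c0Z_single).
- by move=> i y; rewrite c0Z_rnormE le_c0Z_norm.
- move=> i x; rewrite c0Z_rnormE; apply/c0Z_norm_le => j /=.
  by rewrite /single; case: ifP => _ //; rewrite rnorm0 rnorm_ge0.
- by [].
- exact: c0Z_finite_approx.
- by [].
- move=> i x; apply/val_inj/funext => j /=; rewrite /shift_seq /= /single.
  by rewrite [j == _]eq_sym subr_eq eq_sym (fun_if T) linear0.
Qed.

End c0Z_model.

Section lpZ_model.
Context (R : realType) (k : scalar_kind)
  (X : completeNormedModType (scalar_field R k)).
Context (p : R) (hp : 1 <= p).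
Local Notation K := (scalar_field R k).

Let p_neq0 : p != 0. Proof. by rewrite gt_eqF// (lt_le_trans _ hp). Qed.

Definition lpZ_coord (i : int) (y : lpZ X hp) : X := y i.

Lemma lpZ_coord_is_linear i : linear (lpZ_coord i).
Proof. by []. Qed.

HB.instance Definition _ i :=
  GRing.isLinear.Build K (lpZ X hp) X _ (lpZ_coord i) (lpZ_coord_is_linear i).

Lemma psum_le_single i (x : X) (r : R) :
  rnorm x <= r -> psum_le p (rnorm \o single i x) r.
Proof.
move=> xr s us; have r0 := le_trans (rnorm_ge0 x) xr.
rewrite (eq_bigr (fun j => single i (rnorm x `^ p) j)); last first.
  by move=> j _; rewrite /= /single; case: ifP => // _; rewrite rnorm0 powR0.
(* [sum_single] sums over the position of the nonzero entry, so the two indices trade places. *)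
rewrite (eq_bigr (fun j => single j (rnorm x `^ p) i)); last first.
  by move=> j _; rewrite /single eq_sym.
rewrite (sum_single (fun=> rnorm x `^ p))//; case: ifP => _; last exact: powR_ge0.
by rewrite ge0_ler_powR ?nnegrE ?rnorm_ge0// (le_trans _ hp).
Qed.

Lemma single_lpZ i (x : X) : single i x \in lpZ_pred X p.
Proof.
apply/(lpZ_predP hp); exists (rnorm x + 1); first by rewrite ltr_wpDl ?rnorm_ge0.
by apply: psum_le_single; rewrite lerDl.
Qed.

Definition lpZ_single i x : lpZ X hp := LpZ hp (single_lpZ i x).

Lemma lpZ_single_is_linear i : linear (lpZ_single i).
Proof. by move=> a x y; apply/val_inj/funext => j; exact: single_linear. Qed.

HB.instance Definition _ i :=
  GRing.isLinear.Build K X (lpZ X hp) _ (lpZ_single i) (lpZ_single_is_linear i).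

(** Take [s] whose sum is within [e^p] of the supremum; appending a disjoint list [t] cannot exceed
    that supremum, so [t] contributes at most [e^p]. *)
Lemma psum_tail (f : int -> R) (r e : R) : 0 < e -> psum_le p f r ->
  exists2 s : seq int, uniq s & forall t : seq int, uniq t ->
  {in t, forall i, i \notin s} -> \sum_(i <- t) f i `^ p <= e `^ p.
Proof.
move=> e0 fr; pose A := [set \sum_(i <- s) f i `^ p | s in [set s : seq int | uniq s]].
have supA : has_sup A.
  split; first by exists (\sum_(i <- [::]) f i `^ p), [::].
  by exists (r `^ p) => _ [s us <-]; exact: fr.
have [_ [s us <-] sA] := sup_adherent (powR_gt0 p e0) supA.
exists s => // t ut ts; have : A (\sum_(i <- s ++ t) f i `^ p).
  exists (s ++ t) => //=; rewrite cat_uniq us ut andbT/=.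
  by apply/hasPn => i /ts.
by move=> /(ub_le_sup supA.2); rewrite big_cat/=; lra.
Qed.

Lemma lpZ_finite_approx (y : lpZ X hp) (e : R) : 0 < e ->
  exists s : seq int, rnorm (\sum_(i <- s) lpZ_single i (lpZ_coord i y) - y) < e.
Proof.
move=> e0; have e20 : 0 < e / 2 by rewrite divr_gt0.
have [s us sy] := psum_tail e20 (psum_lpZ_norm y).
exists s; set z := (X in rnorm X).
have coord j : z j = if j \in s then 0 else - y j.
  rewrite -[LHS]/(lpZ_coord j z) linearB linear_sum/=.
  have := sum_single y j us; rewrite /lpZ_coord /= => ->.
  by case: ifP => _; rewrite ?subrr ?sub0r.
clearbody z; apply: (@le_lt_trans _ _ (e / 2)); last by rewrite ltr_pdivrMr// ltr_pMr// ltr1n.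
rewrite lpZ_rnormE; apply/lpZ_norm_le => [|t ut]; first exact: ltW.
(* Entries in [s] cancel; the others form a list disjoint from [s], to which the tail estimate
   applies. *)
rewrite (bigID (mem s))/= big1 ?add0r => [|i si]; last first.
  by rewrite coord si rnorm0 powR0.
rewrite -big_filter (eq_big_seq (fun i => (rnorm \o y) i `^ p)) => [|i]; last first.
  by rewrite mem_filter => /andP[/negPf si _]; rewrite coord si rnormN.
apply: sy => [|i]; first exact: filter_uniq.
by rewrite mem_filter => /andP[].
Qed.

Lemma lpZ_shift_tfae (T : {linear X -> X}) (bT : bounded_near T (nbhs 0)) :
  [<-> hypercyclic (B_lp bT hp); weakly_mixing (B_lp bT hp); weakly_mixing T].
Proof.
apply: (@shift_tfae R k X (lpZ X hp) T (B_lp bT hp) bT (B_lp_bounded bT hp)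
  lpZ_coord lpZ_single).
- by move=> i y; rewrite lpZ_rnormE le_lpZ_norm.
- move=> i x; rewrite lpZ_rnormE; apply/lpZ_norm_le; first exact: rnorm_ge0.
  exact: psum_le_single.
- by [].
- exact: lpZ_finite_approx.
- by [].
- move=> i x; apply/val_inj/funext => j /=; rewrite /shift_seq /= /single.
  by rewrite [j == _]eq_sym subr_eq eq_sym (fun_if T) linear0.
Qed.

End lpZ_model.

Unset Implicit Arguments.

Theorem corollary2p8 (R : realType) (k : scalar_kind)
    (X : completeNormedModType (scalar_field R k)) (T : {linear X -> X})
    (bT : bounded_near T (nbhs (0 : X))) :
  [<-> hypercyclic (B_c0 bT);
       weakly_mixing (B_c0 bT);
       weakly_mixing T] /\
  (forall (p : R) (hp : 1 <= p),
    [<-> hypercyclic (B_lp bT hp);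
         weakly_mixing (B_lp bT hp);
         weakly_mixing T]).
Proof. by split=> [|p hp]; [exact: c0Z_shift_tfae|exact: lpZ_shift_tfae]. Qed.
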